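(* Let $\alpha$ be a probability distribution on $[d]$ with $\alpha_1\ge\cdots\ge\alpha_d$, $n\in\mathbb N$, $\lambda\sim\mathrm{SW}^n(\alpha)$. Then for every $k\in[d]$, \[ \mathbb E\Big[\sum_{i=k}^d\lambda_i^2\Big]\le\sum_{i=k}^d(\alpha_i n)^2+d\,(\alpha_k+\alpha_{k+1}+\cdots+\alpha_d)\,n. \]
   Context: $\mathrm{SW}^n(\alpha)$ is the law of the RSK shape $\mathrm{shRSK}(\boldsymbol w)$ (Young diagram $\lambda_1\ge\cdots\ge\lambda_d\ge0$ whose first $k$ rows sum to the maximum total length of $k$ disjoint weakly increasing subsequences of $\boldsymbol w$), where $\boldsymbol w\in[d]^n$ has i.i.d. letters with law $\alpha$. *)

(* Defs.v *)
From HB Require Import structures.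
From mathcomp Require Import all_boot all_order all_algebra.
Set Implicit Arguments. Unset Strict Implicit. Unset Printing Implicit Defensive.
Import Order.TTheory GRing.Theory Num.Theory.

Definition word (d n : nat) := {ffun 'I_n -> 'I_d}.

(* An assignment of positions of w to k labelled subsequences (None = unused)
   is valid when each labelled subsequence is weakly increasing. *)
Definition valid_kseq (d n k : nat) (w : word d n) (f : {ffun 'I_n -> option 'I_k}) : bool :=
  [forall i : 'I_n, forall j : 'I_n,
     ((i < j)%N && (f i != None) && (f i == f j)) ==> (w i <= w j)%N].

Definition greene (d n k : nat) (w : word d n) : nat :=
  \max_(f : {ffun 'I_n -> option 'I_k} | valid_kseq w f) #|[set i | f i != None]|.

(* Row i (0-based, i.e. lambda_{i+1}) of shRSK(w):
   lambda_1 + ... + lambda_k = greene k w. *)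
Definition shRSK_row (d n : nat) (w : word d n) (i : nat) : nat :=
  greene (i.+1) w - greene i w.

Definition word_prob (R : numDomainType) (d n : nat) (alpha : 'I_d -> R) (w : word d n) : R :=
  \prod_(j < n) alpha (w j).

(* Main.v *)
Require Import Defs.
From HB Require Import structures.
From mathcomp Require Import all_boot all_order all_algebra zify ring lra.
Set Implicit Arguments. Unset Strict Implicit. Unset Printing Implicit Defensive.
Import Order.TTheory GRing.Theory Num.Theory.

(** Row insertion identifies the rows of the shape with the increments of [greene]: each insertion is a chain of Knuth relations, which preserve the sizes of unions of [k] chains, and for a tableau these sizes are bounded column by column.

Deleting the letters [< k] reduces the claim to [k = 0]: after reversing and complementing the word, this restricts the insertion tableau to the letters [< d - k]; in a tableau with letters [< d], an entry of row [i + k] forces an entry [< d - k] above it in row [i], so [lambda_(i+k) <= mu_i], where [mu] is the shape of the remaining word.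

For the full sum of squares, let [c] be the sum of the contents [column - row] of the boxes of [mu]; then [sum mu_i^2 = 2 c + sum (2 i + 1) mu_i], and the last sum is at most [d |mu|] because the rows decrease.  The expectation of [c] is that of the number of pairs of equal letters.  Indeed, if the last two boxes are not adjacent, interchanging them in the recording tableau while keeping the insertion tableau is a weight-preserving involution of words; it cancels all contributions to the difference of the last two contents except [+1] for horizontal and [-1] for vertical dominoes.  By the row bumping lemma the same involution shows that the expected difference is [P(x <= y) - P(x > y) = P(x = y)] for the last two letters [x], [y]. *)

(** * Row insertion and its inverse *)

Fixpoint ins_row (r : seq nat) (x : nat) : seq nat * option nat :=
  if r is y :: r' then
    if x < y then (x :: r', Some y)
    else ((y :: (ins_row r' x).1), (ins_row r' x).2)
  else ([:: x], None).

(** The number of rows is fixed and the second component is the row of the new box. It equals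
    [size T] exactly when the last bumped letter falls off, so [(insert T x).2 < size T] says that
    no letter is lost. *)
Fixpoint insert (T : seq (seq nat)) (x : nat) : seq (seq nat) * nat :=
  if T is r :: T' then
    if (ins_row r x).2 is Some y
    then ((ins_row r x).1 :: (insert T' y).1, (insert T' y).2.+1)
    else ((ins_row r x).1 :: T', 0)
  else ([::], 0).

(** On a sorted row with head smaller than [y] this inverts [ins_row]: the last entry smaller than
    [y] is expelled. *)
Fixpoint unins_row (r : seq nat) (y : nat) : seq nat * nat :=
  if r is a :: r' then
    if (if r' is b :: _ then b < y else false)
    then (a :: (unins_row r' y).1, (unins_row r' y).2)
    else (y :: r', a)
  else ([::], 0).

Fixpoint uninsert (T : seq (seq nat)) (i : nat) : seq (seq nat) * nat :=
  if T is r :: T' then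
    if i is j.+1 then
      ((unins_row r (uninsert T' j).2).1 :: (uninsert T' j).1, (unins_row r (uninsert T' j).2).2)
    else (rev (behead (rev r)) :: T', last 0 r)
  else ([::], 0).

Fixpoint row_dom (r s : seq nat) {struct s} : bool :=
  if s is b :: s' then (if r is a :: r' then (a < b) && row_dom r' s' else false)
  else true.

Fixpoint tableau (T : seq (seq nat)) : bool :=
  if T is r :: T' then [&& sorted leq r, row_dom r (head [::] T') & tableau T'] else true.

Lemma ins_row_gt r x y : (ins_row r x).2 = Some y -> x < y.
Proof.
by elim: r => //= a r IH; case: ifP => // lt [<-].
Qed.

Lemma ins_row_none r x : (ins_row r x).2 = None -> (ins_row r x).1 = rcons r x.
Proof. by elim: r => //= a r IH; case: ifP => //= _ /IH ->. Qed.

Lemma ins_row_mem r x y : (ins_row r x).2 = Some y -> y \in r.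
Proof.
elim: r => //= a r IH; case: ifP => /= [_ [->]|_ /IH h]; first exact: mem_head.
by rewrite inE h orbT.
Qed.

Lemma path_ins_row a r x : path leq a r -> a <= x -> path leq a (ins_row r x).1.
Proof.
elim: r a => [|b r IH] a /=; first by move=> _ ->.
case/andP=> ab br ax; case: ifP => /= xb.
  rewrite ax /=; case: r br {IH} => //= c r /andP[bc ->]; rewrite andbT; lia.
by rewrite ab /=; apply: IH => //; lia.
Qed.

Lemma sorted_ins_row r x : sorted leq r -> sorted leq (ins_row r x).1.
Proof.
case: r => //= b r br; case: ifP => /= xb.
  case: r br => //= c r /andP[bc ->]; rewrite andbT; lia.
by apply: path_ins_row => //; lia.
Qed.

Lemma dom_ins_row r s x : row_dom r s -> row_dom (ins_row r x).1 s.
Proof.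
elim: s r => [|b s IH] [|a r] //= /andP[ab rs].
case: ifP => xa /=; first by rewrite rs andbT; lia.
by rewrite ab IH.
Qed.

(** The entry of [s] below the old place of [y], if any, exceeds [y], so [y] lands weakly to the
    left of that place, where the entries above are smaller than [y]. *)
Lemma dom_ins_ins r s x y : row_dom r s -> (ins_row r x).2 = Some y ->
  row_dom (ins_row r x).1 (ins_row s y).1.
Proof.
elim: r s => [|a r IH] s //=.
case: ifP => /= xa.
  move=> + [<-]; case: s => [|b s] /=; first by rewrite xa.
  by case/andP=> -> rs /=; rewrite xa.
move=> + H; case: s => [|b s] /=.
  by move=> _; rewrite andbT; have := ins_row_gt H; lia.
case/andP=> ab rs; case: ifP => yb /=.
  by rewrite dom_ins_row // andbT; have := ins_row_gt H; lia.
by rewrite ab IH.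
Qed.

Lemma tab_ins T x : tableau T -> tableau (insert T x).1.
Proof.
elim: T x => //= r T IH x /and3P[sr rT tT].
case E: (ins_row r x).2 => [y|] /=; rewrite sorted_ins_row //=.
  rewrite IH // andbT; case: T rT {IH tT} => // s T /= rs.
  case F: (ins_row s y).2 => [z|] /=; exact: dom_ins_ins.
by rewrite tT dom_ins_row.
Qed.

Lemma size_ins T x : size (insert T x).1 = size T.
Proof. by elim: T x => //= r T IH x; case: (ins_row r x).2 => //= y; rewrite IH. Qed.

(** Bumped letters strictly increase from row to row, so the letter arriving in row [b] is at least
    [b]; rows up to index [D - 1] therefore absorb every letter below [D]. *)
Lemma ins_index D b T x : all (all (gtn D)) T -> x < D -> D <= b + size T -> b <= x ->
  (insert T x).2 < size T.
Proof.
elim: T b x => [|r T IH] b x /=; first by lia.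
case/andP=> ar aT xD bD bx; case E: (ins_row r x).2 => [y|] //=.
rewrite ltnS; apply: (IH b.+1) => //; last exact: leq_ltn_trans bx (ins_row_gt E).
  by have /(allP ar) := ins_row_mem E.
by lia.
Qed.

Lemma size_ins_row r x :
  size (ins_row r x).1 = (if (ins_row r x).2 is None then 1 else 0) + size r.
Proof.
elim: r => //= a r IH; case: ifP => //= _; rewrite IH; case: (ins_row r x).2 => //=.
Qed.

Lemma shape_ins T x : (insert T x).2 < size T ->
  shape (insert T x).1 = incr_nth (shape T) (insert T x).2.
Proof.
elim: T x => //= r T IH x.
have := size_ins_row r x; case E: (ins_row r x).2 => [y|] /= -> //.
by rewrite ltnS => /IH; rewrite /shape => ->.
Qed.

Lemma ins_row_perm r x :
  perm_eq (x :: r) (if (ins_row r x).2 is Some y then y :: (ins_row r x).1 else (ins_row r x).1).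
Proof.
elim: r => //= a r IH; case: ifP => /= _.
  by apply/permP => p /=; lia.
by case: (ins_row r x).2 IH => [y|] /permP IH; apply/permP => p;
   have /= := IH p; lia.
Qed.

Fixpoint reading {A : Type} (T : seq (seq A)) : seq A :=
  if T is r :: T' then reading T' ++ r else [::].

Lemma perm_rd_ins T x : (insert T x).2 < size T -> perm_eq (x :: reading T) (reading (insert T x).1).
Proof.
elim: T x => //= r T IH x.
have := ins_row_perm r x; case: (ins_row r x).2 => [y|] /= /permP h.
  rewrite ltnS => /IH /permP h2; apply/permP => p.
  by have := h p; have := h2 p; rewrite /= !count_cat; lia.
by move=> _; apply/permP => p; have := h p; rewrite /= !count_cat; lia.
Qed.

Lemma un_row_mem r y : r != [::] -> (unins_row r y).2 \in r.
Proof.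
elim: r => //= a r IH _; case: r IH => [|b r] IH; first by rewrite mem_head.
case: ifP => _; last by rewrite mem_head.
by rewrite inE IH ?orbT.
Qed.

Lemma ins_un_row r y : sorted leq r -> r != [::] -> head 0 r < y ->
  ins_row (unins_row r y).1 (unins_row r y).2 = (r, Some y).
Proof.
elim: r => //= a r IH pr _ ay.
case: ifP => h /=; last by rewrite ay.
have r0 : r != [::] by case: r h {IH pr}.
have := un_row_mem y r0; set x := (unins_row r y).2 => xr.
have ax : a <= x by move: pr; rewrite (path_sortedE leq_trans) => /andP[/allP h0 _]; exact: h0.
rewrite ltnNge ax /= IH //; first exact: path_sorted pr.
by case: r h {IH pr r0 x xr ax}.
Qed.

Lemma un_ins_row r x y : sorted leq r -> (ins_row r x).2 = Some y ->
  unins_row (ins_row r x).1 y = (r, x).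
Proof.
elim: r => //= a r IH pr.
case: ifP => /= xa.
  move=> [<-]; case: r pr {IH} => //= b r /andP[ab _]; rewrite ifF //; lia.
move=> H; rewrite IH //; last exact: path_sorted pr.
rewrite ifT // ; have := ins_row_gt H.
case: r H {IH pr} => //= b r; case: ifP => //= *; lia.
Qed.

Lemma un_ins T x : tableau T -> (insert T x).2 < size T -> uninsert (insert T x).1 (insert T x).2 = (T, x).
Proof.
elim: T x => //= r T IH x /and3P[sr _ tT].
case E: (ins_row r x).2 => [y|] /=.
  by rewrite ltnS => H; rewrite IH //= un_ins_row.
by move=> _; rewrite (ins_row_none E) rev_rcons /= revK last_rcons.
Qed.

Lemma un_row_rec a b r y : b < y -> unins_row [:: a, b & r] y =
  (a :: (unins_row (b :: r) y).1, (unins_row (b :: r) y).2).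
Proof. by move=> /= ->. Qed.

Lemma un_row_here a r y : y <= head y r -> unins_row (a :: r) y = (y :: r, a).
Proof. by case: r => //= b r; rewrite leqNgt => /negbTE ->. Qed.

Lemma dom_un_row r s y : row_dom r s -> all (ltn y) s -> row_dom (unins_row r y).1 s.
Proof.
elim: s r => [|b s IH] [|a r] //= /andP[ab rs] /andP[yb ys].
case: ifP => _ /=; first by rewrite ab IH.
by rewrite rs yb.
Qed.

Lemma dom_nil r s : row_dom r s -> s != [::] -> r != [::].
Proof. by case: r s => [|a r] [|b s]. Qed.

(** The letter expelled from [s] exceeds the entry above it, so it lands in [r] weakly to the right,
    above letters of the new [s] that are at least [z]. *)
Lemma dom_un_un r s z : sorted leq s -> row_dom r s -> s != [::] -> head 0 s < z ->
  row_dom (unins_row r (unins_row s z).2).1 (unins_row s z).1.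
Proof.
elim: s r => [|b s IH] [|a r] // ps /andP[ab rs] _; rewrite [head _ _]/= => bz.
case: s IH ps rs => [|c s] IH ps rs.
  by have /= := @dom_un_row (a :: r) [:: z] b; rewrite /= bz (ltn_trans ab bz) => /(_ isT isT).
case: r rs => // a2 r /andP[a2c rs].
have [cz|zc] := ltnP c z.
  have cy : c <= (unins_row (c :: s) z).2.
    have := un_row_mem z (isT : c :: s != [::]); rewrite inE => /orP[/eqP->//|].
    by move: ps => /= /andP[_]; rewrite (path_sortedE leq_trans) => /andP[/allP h _] /h.
  rewrite (un_row_rec _ _ cz) (un_row_rec _ _ (leq_trans a2c cy)); apply/andP; split => //.
  by apply: IH => //; [case/andP: ps|apply/andP].
rewrite (@un_row_here b _ z) //.
have H : row_dom [:: a, a2 & r] [:: z, c & s].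
  by apply/andP; split; [exact: ltn_trans ab bz|apply/andP].
change (row_dom (unins_row [:: a, a2 & r] b).1 [:: z, c & s]).
apply: (dom_un_row H) => /=; rewrite bz.
have bc : b <= c by case/andP: ps.
have := path_sorted ps; rewrite [sorted _ _]/= (path_sortedE leq_trans) => /andP[/allP h _].
have -> /= : b < c by lia.
by apply/allP => t /h /=; lia.
Qed.

(** The letter removed from the end of [s] lands in [r] weakly to the right of its column, beyond
    all that is left of [s]. *)
Lemma dom_un_last r s : sorted leq s -> row_dom r s ->
  row_dom (unins_row r (last 0 s)).1 (rev (behead (rev s))).
Proof.
case/lastP: s => // s y; rewrite last_rcons rev_rcons /= revK.
elim: s r => [|b s IH] [|a r] // ps /andP[ab rs].
case: r rs => [|a2 r]; first by case: s {IH ps}.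
move=> rs.
have a2y : a2 < y.
  case: s rs ps {IH} => /= [/andP[] //|c s /andP[a2c _] /andP[_]].
  rewrite (path_sortedE leq_trans) all_rcons /=; lia.
rewrite (un_row_rec _ _ a2y); apply/andP; split => //.
by apply: IH => //; exact: path_sorted ps.
Qed.

Lemma sorted_un_row r y : sorted leq r -> head 0 r < y -> sorted leq (unins_row r y).1.
Proof.
elim: r => //= a r IH pr ay.
case: r IH pr => //= b r IH /andP[ab br].
case: ifP => // by_ /=; last by rewrite br andbT; lia.
have := IH br by_; case: ifP => //= h ->; rewrite ?ab //.
by rewrite andbT; lia.
Qed.

Lemma sorted_rev_behead_rev s : sorted leq s -> sorted leq (rev (behead (rev s))).
Proof.
case/lastP: s => // s y; rewrite rev_rcons /= revK.
by rewrite -cats1 => /cat_sorted2[].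
Qed.

Lemma dom_rev_behead_rev r s : row_dom r s -> size s < size r -> row_dom (rev (behead (rev r))) s.
Proof.
case/lastP: r => [|r y]; first by case: s.
rewrite rev_rcons /= revK size_rcons ltnS.
elim: s r => [|b s IH] [|a r] //= /andP[-> rs] h /=; exact: IH.
Qed.

Lemma dom_size r s : row_dom r s -> size s <= size r.
Proof. by elim: s r => [|b s IH] [|a r] //= /andP[_ /IH]. Qed.

Lemma head_le_mem s y : sorted leq s -> y \in s -> head 0 s <= y.
Proof.
case: s => //= a s; rewrite (path_sortedE leq_trans) inE => /andP[/allP h _].
by case/orP=> [/eqP->|/h].
Qed.

Definition corner (T : seq (seq nat)) i :=
  (i < size T) && (size (nth [::] T i.+1) < size (nth [::] T i)).

Lemma dom_head_lt r s y : sorted leq s -> row_dom r s -> y \in s -> head 0 r < y.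
Proof.
move=> ss; case: s ss => // b s ss; case: r => // a r /andP[ab _] /(head_le_mem ss).
exact: leq_trans ab.
Qed.

Lemma tab_head_sorted T : tableau T -> sorted leq (head [::] T).
Proof. by case: T => //= r T /andP[]. Qed.

Lemma un_mem T i : tableau T -> corner T i -> (uninsert T i).2 \in head [::] T.
Proof.
elim: T i => [|r T IH] [|i] //=; rewrite /corner /=.
  by case: r => //= a r _ _; exact: mem_last.
move=> /and3P[_ rT tT] h; apply: un_row_mem; apply: dom_nil rT _.
by have := IH i tT h; case: (head _ T).
Qed.

Lemma unP T i : tableau T -> corner T i ->
  [/\ tableau (uninsert T i).1, insert (uninsert T i).1 (uninsert T i).2 = (T, i) & size (uninsert T i).1 = size T].
Proof.
elim: T i => [|r T IH] [|i] //=.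
  rewrite /corner /= nth0 => /and3P[sr rT tT] h; split => //=.
    by rewrite sorted_rev_behead_rev //= tT dom_rev_behead_rev.
  case/lastP: r sr rT h => // r y sr _ _; rewrite rev_rcons /= revK last_rcons.
  have -> : ins_row r y = (rcons r y, None); last by [].
  elim: r sr => //= a r IHr pr.
  have ay : a <= y.
    by move: pr; rewrite (path_sortedE leq_trans) all_rcons => /andP[/andP[]].
  by rewrite ltnNge ay /= IHr //; exact: path_sorted pr.
rewrite /corner /= => /and3P[sr rT tT] h.
have [tu iu su] := IH i tT h.
have mu := un_mem tT h.
have sT := tab_head_sorted tT.
have ry := dom_head_lt sT rT mu.
have rn0 : r != [::] by apply: dom_nil rT _; case: (head _ T) mu.
split; rewrite ?su //=; last by rewrite ins_un_row //= iu.
rewrite sorted_un_row //= tu andbT.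
case: T tT h rT sT {IH tu iu su mu ry} => // s T /and3P[_ sT tT] h rT ss.
case: i h => [|i] h; first exact: dom_un_last.
have mu := un_mem tT h.
apply: dom_un_un => //; last exact: dom_head_lt (tab_head_sorted tT) sT mu.
by apply: dom_nil sT _; case: (head _ T) mu.
Qed.

Lemma ins_row_bump_le r p q : sorted leq r -> p <= q ->
  let o := (ins_row r p).2 in let o' := (ins_row (ins_row r p).1 q).2 in
  if o' is Some y' then exists2 y, o = Some y & y <= y' else true.
Proof.
move=> + pq; elim: r => [_|a r IH] /=; first by rewrite ltnNge pq.
move=> pr; case: ifP => pa /=.
  rewrite ltnNge pq /=; case E: (ins_row r q).2 => [y'|] //=; exists a => //.
  have := ins_row_mem E; move: pr; rewrite (path_sortedE leq_trans) => /andP[/allP h _]; exact: h.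
have -> : (q < a) = false by lia.
by apply: IH; exact: path_sorted pr.
Qed.

Lemma ins_row_bump_gt r p q : q < p ->
  exists2 y', (ins_row (ins_row r p).1 q).2 = Some y' & y' <= p.
Proof.
move=> qp; elim: r => [|a r IH] /=; first by rewrite qp; exists p.
case: ifP => pa /=; first by rewrite qp; exists p.
by case: ifP => //= qa; exists a => //; lia.
Qed.

(** If [p <= q], the bumped letters stay weakly ordered and the second path ends no later than the
    first. If [q < p], the second insertion bumps a letter [<= p], hence smaller than the one bumped
    first, and its path ends strictly lower. *)
Lemma row_bumping T p q : tableau T -> (insert (insert T p).1 q).2 < size T ->
  ((insert (insert T p).1 q).2 <= (insert T p).2) = (p <= q).
Proof.
elim: T p q => //= r T IH p q /and3P[sr _ tT].
have [pq|qp] := leqP p q.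
  have := ins_row_bump_le sr pq; case E: (ins_row r p).2 => [y|] /=.
    case F: (ins_row _ q).2 => [y'|] //= -[_ [<-] yy'].
    by rewrite !ltnS => h; rewrite IH.
  by case F: (ins_row _ q).2 => [y'|] //= -[].
have [y' F y'p] := ins_row_bump_gt r qp.
case E: (ins_row r p).2 => [y|] /=; rewrite F //= !ltnS => h; rewrite IH //.
by have := ins_row_gt E; lia.
Qed.

(** * Restriction of a tableau to the letters below a bound *)

Lemma ins_row_filter r x m : sorted leq r ->
  let s := [seq z <- r | z < m] in
  if x < m then
   [seq z <- (ins_row r x).1 | z < m] = (ins_row s x).1 /\
   (ins_row s x).2 = (if (ins_row r x).2 is Some y then (if y < m then Some y else None) else None)
  else [seq z <- (ins_row r x).1 | z < m] = s.
Proof.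
elim: r => [_|a r IH pr] /=; first by case: ifP => //= ->.
have := IH (path_sorted pr) => {}IH.
case: ifP IH => xm IH.
  case: ifP => xa /=.
    rewrite xm; case am: (a < m) => /=; rewrite ?xa //.
    have -> : [seq z <- r | z < m] = [::]; last by [].
    move: (pr); rewrite [sorted _ _]/= (path_sortedE leq_trans) => /andP[/allP h _].
    rewrite -(filter_pred0 r); apply: eq_in_filter => z /h /=; lia.
  have am : a < m by lia.
  by rewrite am /= xa /=; case: IH => -> ->.
case: ifP => xa /=; rewrite ?xm ?IH //.
by rewrite ifF //; lia.
Qed.

(** Letters bump only larger ones, so a letter [>= m] never displaces a letter [< m]; a bumping path
    that reaches a letter [>= m] ends there in the restricted tableau. *)
Lemma ins_filter T x m : tableau T ->
  let T' := [seq [seq z <- r | z < m] | r <- T] in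
  [seq [seq z <- r | z < m] | r <- (insert T x).1] = (if x < m then (insert T' x).1 else T').
Proof.
elim: T x => [|r T IH] x; first by rewrite /=; case: ifP.
case/and3P => sr _ tT; rewrite /=; have := ins_row_filter x m sr.
case: ifP => xm.
  case E: (ins_row r x).2 => [y|] /= [-> ->] //.
  by rewrite IH //; case: ifP.
case E: (ins_row r x).2 => [y|] /= -> //.
by rewrite IH // ifF //; have := ins_row_gt E; lia.
Qed.

Lemma dom_count r s m : row_dom r s -> count (gtn m.+1) s <= count (gtn m) r.
Proof. by elim: s r => [|b s IH] [|a r] //= /andP[ab /IH]; lia. Qed.

Lemma tab_dom T i : tableau T -> row_dom (nth [::] T i) (nth [::] T i.+1).
Proof.
elim: T i => [|r T IH] i; first by rewrite !nth_nil.
by case/and3P => _ rT tT; case: i => [|i] /=; [rewrite nth0|exact: IH].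
Qed.

(** By column strictness, each step up a column lowers the entry by at least one. *)
Lemma tab_interlace T i k m : tableau T -> all (all (gtn (m + k))) T ->
  size (nth [::] T (i + k)) <= count (gtn m) (nth [::] T i).
Proof.
move=> tT aT.
have -> : size (nth [::] T (i + k)) = count (gtn (m + k)) (nth [::] T (i + k)).
  apply/esym/eqP; rewrite -all_count.
  have [h|h] := ltnP (i + k) (size T); first exact: (allP aT _ (mem_nth _ h)).
  by rewrite nth_default.
elim: k {aT} => [|k IH]; first by rewrite !addn0.
rewrite !addnS; apply: leq_trans (dom_count _ (tab_dom _ tT)) IH.
Qed.

(** * Greene's theorem *)

Definition compat (k : nat) (p q : nat * nat) : bool :=
  (p.2 == q.2) && (p.2 < k) ==> (p.1 <= q.1).

Definition coloured (k : nat) (p : nat * nat) : bool := p.2 < k.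

Definition has_chains (k : nat) (w : seq nat) (m : nat) : Prop :=
  exists cw, [/\ [seq p.1 | p <- cw] = w, pairwise (compat k) cw & count (coloured k) cw = m].

Lemma map_eq_cat (A B : Type) (f : A -> B) s u v : map f s = u ++ v ->
  exists s1 s2, [/\ s = s1 ++ s2, map f s1 = u & map f s2 = v].
Proof.
move=> h; exists (take (size u) s), (drop (size u) s).
by rewrite cat_take_drop map_take map_drop h take_size_cat // drop_size_cat.
Qed.

Lemma chains_swap k u v (p q : nat * nat) : compat k q p ->
  pairwise (compat k) (u ++ [:: p; q] ++ v) -> pairwise (compat k) (u ++ [:: q; p] ++ v).
Proof.
move=> h; rewrite [in X in X -> _]/= [in X in _ -> X]/= !pairwise_cat /= !allrel_consr h /=.
case/and3P=> /and3P[-> -> ->] -> /andP[/andP[_ ->] /andP[-> ->]].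
by [].
Qed.

Definition swap_colours (a c : nat) (p : nat * nat) : nat * nat :=
  (p.1, if p.2 == a then c else if p.2 == c then a else p.2).

Lemma pairwise_recol k a c s : a < k -> c < k ->
  pairwise (compat k) (map (swap_colours a c) s) = pairwise (compat k) s.
Proof.
move=> ak ck; rewrite pairwise_map; apply: eq_pairwise => p q.
by rewrite /relpre /compat /swap_colours /=; do !case: ifP => ?; lia.
Qed.

Lemma count_recol k a c s : a < k -> c < k ->
  count (coloured k) (map (swap_colours a c) s) = count (coloured k) s.
Proof.
move=> ak ck; rewrite count_map; apply: eq_count => p.
by rewrite /coloured /swap_colours /=; do !case: ifP => ?; lia.
Qed.

(* The only obstruction is a chain using both [x] and [z]: it can take [y] instead of [x] if [y]
   is unused, and otherwise it is crossed with the chain through [y], by exchanging their colours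
   before the moved block in [knuth1] and after it in [knuth2]. *)
Lemma knuth1 k u v x y z m : x < y <= z ->
  has_chains k (u ++ [:: y; z; x] ++ v) m <-> has_chains k (u ++ [:: y; x; z] ++ v) m.
Proof.
move=> xyz; split=> -[cw []] /map_eq_cat[cu [s [-> <-]]] /map_eq_cat[t [cv [-> + <-]]] {cw s}.
  case: t => [|[y' a] [|[z' b] [|[x' c] [|]]]] //= [-> -> ->] hv <-.
  exists (cu ++ [:: (y, a); (x, c); (z, b)] ++ cv); split; first by rewrite !map_cat.
    have := @chains_swap k (rcons cu (y, a)) cv (z, b) (x, c).
    rewrite !cat_rcons; apply => //; rewrite /compat /=; lia.
  by rewrite !count_cat /=; lia.
case: t => [|[y' a] [|[x' c] [|[z' b] [|]]]] //= [-> -> ->] hv <-.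
have [/andP[/eqP bc ck]|nbc] := boolP ((b == c) && (c < k)); last first.
  exists (cu ++ [:: (y, a); (z, b); (x, c)] ++ cv); split; first by rewrite !map_cat.
    have := @chains_swap k (rcons cu (y, a)) cv (x, c) (z, b).
    by rewrite !cat_rcons; apply => //; rewrite /compat /=; lia.
  by rewrite !count_cat /=; lia.
subst b.
have ac : (a == c) = false.
  apply/negP => /eqP ac; move: hv; rewrite pairwise_cat => /and3P[_ _ /= /andP[/andP[h _] _]].
  move: h; rewrite /compat /=; lia.
pose cu' := if a < k then map (swap_colours a c) cu else cu.
have mcu : [seq p.1 | p <- cu'] = [seq p.1 | p <- cu].
  by rewrite /cu'; case: ifP => // _; rewrite -map_comp.
have pcu : pairwise (compat k) cu' = pairwise (compat k) cu.
  by rewrite /cu'; case: ifP => // ak; rewrite pairwise_recol.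
have ccu : count (coloured k) cu' = count (coloured k) cu.
  by rewrite /cu'; case: ifP => // ak; rewrite count_recol.
exists (cu' ++ [:: (y, c); (z, c); (x, a)] ++ cv); split.
- by rewrite !map_cat mcu.
- move: hv; rewrite -[_ :: _]/([:: (y, a); (x, c); (z, c)] ++ cv) !pairwise_cat pcu !allrel_catr.
  case/and3P=> /andP[/allrelP h1 /allrelP h2] -> /and3P[/allrelP h3 _ ->].
  rewrite !andbT /=.
  have cvP q : q \in cv -> [/\ compat k (y, a) q, compat k (x, c) q & compat k (z, c) q].
    by move=> qv; split; apply: h3 => //; rewrite !inE eqxx ?orbT.
  have cuP p : p \in cu -> [/\ compat k p (y, a), compat k p (x, c), compat k p (z, c) &
      {in cv, forall q, compat k p q}].
    by move=> pu; split; [apply: h1 => //; rewrite !inE eqxx ?orbT..|move=> q; exact: h2].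
  apply/and3P; split.
  (* If [a < k], the part of a chain in [cu] bounded by [x] now continues with [x] and letters of
     [cv] that are [>= y]; the part bounded by [y] continues with [y], [z] and letters [>= z]. *)
  + have H p : p \in cu' -> [/\ compat k p (y, c), compat k p (x, a), compat k p (z, c) &
      {in cv, forall q, compat k p q}].
      rewrite /cu'; case: ifP => ak.
        case/mapP => -[p1 p2] /cuP[]; rewrite /compat /swap_colours /= => e1 e2 e3 e4 ->.
        split=> /=; [by do !case: ifP => ?; lia..|].
        move=> [q1 q2] qv; have /= := e4 _ qv; have [] := cvP _ qv; rewrite /compat /=.
        by do !case: ifP => ?; lia.
      case: p => p1 p2 /cuP[]; rewrite /compat /= => e1 e2 e3 e4; split; [lia..|exact: e4].
    apply/andP; split; apply/allrelP => p q pu.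
      by have [h4 h5 h6 _] := H p pu; rewrite !inE => /or3P[]/eqP->.
    by move=> qv; have [_ _ _ h] := H p pu; exact: h.
  + apply/allrelP => p [q1 q2] + /cvP[]; rewrite /compat /= !inE => + e1 e2 e3.
    by case/or3P=>/eqP-> /=; lia.
  + by rewrite /compat /=; lia.
- by rewrite !count_cat ccu /coloured /=; lia.
Qed.

Lemma knuth2 k u v x y z m : x <= y < z ->
  has_chains k (u ++ [:: x; z; y] ++ v) m <-> has_chains k (u ++ [:: z; x; y] ++ v) m.
Proof.
move=> xyz; split=> -[cw []] /map_eq_cat[cu [s [-> <-]]] /map_eq_cat[t [cv [-> + <-]]] {cw s};
  last first.
  case: t => [|[z' b] [|[x' c] [|[y' a] [|]]]] //= [-> -> ->] hv <-.
  exists (cu ++ [:: (x, c); (z, b); (y, a)] ++ cv); split; first by rewrite !map_cat.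
    apply: (@chains_swap k cu ((y, a) :: cv) (z, b) (x, c)) hv.
    by rewrite /compat /=; lia.
  by rewrite !count_cat /=; lia.
case: t => [|[x' c] [|[z' b] [|[y' a] [|]]]] //= [-> -> ->] hv <-.
have [/andP[/eqP bc ck]|nbc] := boolP ((b == c) && (c < k)); last first.
  exists (cu ++ [:: (z, b); (x, c); (y, a)] ++ cv); split; first by rewrite !map_cat.
    apply: (@chains_swap k cu ((y, a) :: cv) (x, c) (z, b)) hv.
    by rewrite /compat /=; lia.
  by rewrite !count_cat /=; lia.
subst b.
have ac : (a == c) = false.
  apply/negP => /eqP ac; move: hv; rewrite pairwise_cat => /and3P[_ _ /= /and3P[_ /andP[h _] _]].
  move: h; rewrite /compat /=; lia.
pose cv' := if a < k then map (swap_colours a c) cv else cv.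
have mcv : [seq p.1 | p <- cv'] = [seq p.1 | p <- cv].
  by rewrite /cv'; case: ifP => // _; rewrite -map_comp.
have pcv : pairwise (compat k) cv' = pairwise (compat k) cv.
  by rewrite /cv'; case: ifP => // ak; rewrite pairwise_recol.
have ccv : count (coloured k) cv' = count (coloured k) cv.
  by rewrite /cv'; case: ifP => // ak; rewrite count_recol.
exists (cu ++ [:: (z, a); (x, c); (y, c)] ++ cv'); split.
- by rewrite !map_cat mcv.
- move: hv; rewrite -[_ :: _]/([:: (x, c); (z, c); (y, a)] ++ cv) !pairwise_cat pcv !allrel_catr.
  case/and3P=> /andP[/allrelP h1 /allrelP h2] -> /and3P[/allrelP h3 _ ->].
  rewrite !andbT /=.
  have cvP q : q \in cv -> [/\ compat k (y, a) q, compat k (x, c) q, compat k (z, c) q &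
      {in cu, forall p, compat k p q}].
    by move=> qv; split; [apply: h3 => //; rewrite !inE eqxx ?orbT..|move=> p pu; exact: h2].
  have cuP p : p \in cu -> [/\ compat k p (y, a), compat k p (x, c) & compat k p (z, c)].
    by move=> pu; split; apply: h1 => //; rewrite !inE eqxx ?orbT.
  have H q : q \in cv' -> [/\ compat k (z, a) q, compat k (x, c) q, compat k (y, c) q &
      {in cu, forall p, compat k p q}].
    rewrite /cv'; case: ifP => ak.
      case/mapP => -[p1 p2] /cvP[]; rewrite /compat /swap_colours /= => e1 e2 e3 e4 ->.
      split=> /=; [by do !case: ifP => ?; lia..|].
      move=> [q1 q2] qv; have /= := e4 _ qv; have [] := cuP _ qv; rewrite /compat /=.
      by do !case: ifP => ?; lia.
    case: q => p1 p2 /cvP[]; rewrite /compat /= => e1 e2 e3 e4; split; [lia..|exact: e4].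
  apply/and3P; split.
  + apply/andP; split; apply/allrelP.
      by move=> [p1 p2] q /cuP[]; rewrite !inE /compat /= => e1 e2 e3 /or3P[]/eqP-> /=; lia.
    by move=> p q pu /H[_ _ _]; apply.
  + by apply/allrelP => p q + /H[] => + e1 e2 e3 _; rewrite !inE => /or3P[]/eqP->.
  + by rewrite /compat /=; lia.
- by rewrite !count_cat ccv /coloured /=; lia.
Qed.

(** Quantifying over the contexts makes this a congruence, so that Knuth relations apply inside a
    word. *)
Definition chain_equiv (w w' : seq nat) : Prop := forall k m u v,
  has_chains k (u ++ w ++ v) m <-> has_chains k (u ++ w' ++ v) m.

Lemma chain_equiv_trans w1 w2 w3 :
  chain_equiv w1 w2 -> chain_equiv w2 w3 -> chain_equiv w1 w3.
Proof. by move=> h1 h2 k m u v; rewrite h1. Qed.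

Lemma chain_equiv_ctx a b w w' :
  chain_equiv w w' -> chain_equiv (a ++ w ++ b) (a ++ w' ++ b).
Proof. by move=> h k m u v; have := h k m (u ++ a) (b ++ v); rewrite !catA. Qed.

Lemma chain_equiv_row_left a r x : path leq a r -> x < a ->
  chain_equiv (a :: rcons r x) [:: a, x & r].
Proof.
elim: r a => [|b r IH] a //= /andP[ab br] xa.
apply: (@chain_equiv_trans _ [:: a, b, x & r]).
  have := chain_equiv_ctx [:: a] [::] (IH b br (leq_trans xa ab)).
  by rewrite /= !cats0.
apply: (@chain_equiv_ctx [::] r [:: a; b; x] [:: a; x; b]) => k m u v.
by apply: knuth1; lia.
Qed.

(** By [knuth1] the letter [x] moves left until it stands just behind the letter [y] that it bumps;
    by [knuth2] the letter [y] then moves to the front. *)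
Lemma chain_equiv_ins_row r x y : sorted leq r -> (ins_row r x).2 = Some y ->
  chain_equiv (rcons r x) (y :: (ins_row r x).1).
Proof.
elim: r => //= a r IH pr; case: ifP => /= xa; first by move=> [<-]; exact: chain_equiv_row_left.
move=> H; have xy := ins_row_gt H.
apply: (@chain_equiv_trans _ [:: a, y & (ins_row r x).1]).
  have := chain_equiv_ctx [:: a] [::] (IH (path_sorted pr) H).
  by rewrite /= !cats0.
have : path leq a (ins_row r x).1 by apply: path_ins_row => //; lia.
(* The head of the new row is the third letter of the Knuth relation; it is [x] or an entry
   [<= x]. *)
have : head y (ins_row r x).1 < y.
  by case: r H {IH pr} => //= b r; case: ifP => //=; lia.
case: (ins_row r x).1 => [|h t] /= hy; first by lia.
case/andP=> ah _.
apply: (@chain_equiv_ctx [::] t [:: a; y; h] [:: y; a; h]) => k m u v.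
by apply: knuth2; lia.
Qed.

Lemma chain_equiv_ins T x : tableau T -> (insert T x).2 < size T ->
  chain_equiv (rcons (reading T) x) (reading (insert T x).1).
Proof.
elim: T x => //= r T IH x /and3P[sr _ tT].
case E: (ins_row r x).2 => [y|] /=; last by rewrite (ins_row_none E) rcons_cat.
rewrite ltnS => h.
apply: (@chain_equiv_trans _ (reading T ++ y :: (ins_row r x).1)).
  have := chain_equiv_ctx (reading T) [::] (chain_equiv_ins_row sr E).
  by rewrite !cats0 rcons_cat.
have := chain_equiv_ctx [::] (ins_row r x).1 (IH y tT h).
by rewrite /= cat_rcons.
Qed.

(** * Chains in the reading word of a tableau *)

Lemma tab_behead T : tableau T -> tableau (map behead T).
Proof.
elim: T => //= r T IH /and3P[sr rT /IH ->]; rewrite andbT.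
apply/andP; split; first by case: r sr {rT} => //= a r; exact: path_sorted.
by case: T rT {IH} => //= s T; case: s => [|b s] //; case: r {sr} => //= a r /andP[].
Qed.

Lemma rd_cat_perm A (T : seq (seq A)) p :
  count p (reading T) = count p (pmap ohead T) + count p (reading (map behead T)).
Proof.
by elim: T => //= r T IH; case: r => [|a r] /=; rewrite ?cats0 // !count_cat /= IH; lia.
Qed.

Lemma subseq_rd_behead (T : seq (seq (nat * nat))) : subseq (reading (map behead T)) (reading T).
Proof.
elim: T => //= r T IH; apply: cat_subseq => //; case: r => //= a r; exact: subseq_cons.
Qed.

Lemma tab_head_lt T a r0 : tableau (r0 :: T) -> a \in pmap ohead T -> 0 < size r0 /\ head 0 r0 < a.
Proof.
elim: T r0 => //= r T IH r0 /andP[_ /andP[rT tT]].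
case: r rT tT => [|b r] rT tT /=; first by case/(IH [::] tT).
case: r0 rT => // c r0 /andP[cb _].
by rewrite inE => /orP[/eqP->|/(IH (b :: r) tT)[_ /=]] /=; lia.
Qed.

(** The reading word runs through a column from bottom to top, hence strictly downwards in value, so
    a weakly increasing chain meets a column at most once. *)
Lemma column_chains k (cT : seq (seq (nat * nat))) :
  tableau (map (map fst) cT) -> pairwise (compat k) (reading cT) ->
  uniq [seq p.2 | p <- pmap ohead cT & coloured k p].
Proof.
elim: cT => //= r cT IH /and3P[sr rT tT]; rewrite pairwise_cat => /and3P[/allrelP h p1 p2].
case: r sr rT h {p2} => [|[a c] r] sr rT h /=; first exact: IH.
rewrite /coloured /=; case: ifP => /= ck; last exact: IH.
rewrite IH // andbT; apply/negP => /mapP[[b c']]; rewrite mem_filter /coloured /= => /andP[c'k hb] e.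
subst c'.
have bT : b \in pmap ohead (map (map fst) cT).
  elim: cT hb {IH sr rT tT h p1} => //= s cT IH; case: s => [|q s] //=.
  by rewrite !inE => /orP[/eqP<-|/IH ->]; rewrite ?eqxx ?orbT.
have [_ ab] : 0 < size (a :: map fst r) /\ head 0 (a :: map fst r) < b.
  by apply: (@tab_head_lt (map (map fst) cT)) => //=; rewrite -[path _ _ _]/(sorted leq (a :: map fst r)) sr rT.
have : compat k (b, c) (a, c).
  apply: h; last by rewrite mem_head.
  elim: cT hb {IH sr rT tT p1 bT} => //= s cT IH; rewrite mem_cat; case: s => [|q s] //=.
    by move/IH ->.
  by rewrite !inE => /orP[->|/IH ->]; rewrite ?orbT.
by rewrite /compat /= eqxx ck /=; move: ab => /=; lia.
Qed.

Lemma tab_size_mono T i : tableau T -> size (nth [::] T i.+1) <= size (nth [::] T i).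
Proof. by move/(tab_dom i)/dom_size. Qed.

(** The nonempty rows come first, so the first [k] rows contain [minn k l] boxes of a first column
    of length [l]. *)
Lemma count_heads T k : tableau T ->
  minn k (size (pmap ohead T)) + \sum_(i < k) size (nth [::] (map behead T) i)
  <= \sum_(i < k) size (nth [::] T i).
Proof.
elim: T k => [|r T IH] [|k] tT.
- by rewrite !big_ord0.
- by rewrite /= minn0.
- by rewrite !big_ord0 min0n.
rewrite !big_ord_recl /=.
have tT' : tableau T by case/and3P: tT.
have := IH k tT'.
case: r tT => [|a r] /= tT; last first.
  by rewrite minnSS /=; move: (\sum_(i < k) _) (\sum_(i < k) _) => A B; lia.
have all0 : pmap ohead T = [::].
  case E: (pmap ohead T) => [|b s] //.
  have bT : b \in pmap ohead T by rewrite E mem_head.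
  by have [] := @tab_head_lt T b [::] tT bT.
by rewrite all0 /= !minn0; move: (\sum_(i < k) _) (\sum_(i < k) _) => A B; lia.
Qed.

(** Induction on the number of columns: [k] chains cover at most [minn k l] letters of a column of
    length [l], and these bounds add up to the size of the first [k] rows. *)
Lemma tab_chains_le k (cT : seq (seq (nat * nat))) :
  tableau (map (map fst) cT) -> pairwise (compat k) (reading cT) ->
  count (coloured k) (reading cT) <= \sum_(i < k) size (nth [::] cT i).
Proof.
have [n] := ubnP (size (head [::] cT)).
elim: n cT => // n IH cT hn tT pT.
have [h0|hpos] := posnP (size (head [::] cT)).
  suff -> : reading cT = [::] by [].
  elim: cT h0 tT {pT hn IH} => //= r cT IH; case: r => //= _ /andP[rT tT].
  by rewrite IH //; case: cT rT {tT IH} => //= s cT; case: s.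
rewrite rd_cat_perm.
have e (X : seq (seq (nat * nat))) i : size (nth [::] X i) = size (nth [::] (map (map fst) X) i).
  have [hi|hi] := ltnP i (size X); first by rewrite (nth_map [::]) // size_map.
  by rewrite !nth_default // size_map.
have eb : map (map fst) (map behead cT) = map behead (map (map fst) cT).
  by rewrite -!map_comp; apply: eq_map => -[].
apply: leq_trans (_ : minn k (size (pmap ohead cT)) + \sum_(i < k) size (nth [::] (map behead cT) i) <= _).
  apply: leq_add.
    rewrite leq_min count_size andbT -size_filter -(size_map snd).
    rewrite -[X in _ <= X](size_iota 0); apply: uniq_leq_size; first exact: column_chains.
    by move=> c /mapP[p]; rewrite mem_filter /coloured => /andP[h _] ->; rewrite mem_iota.
  apply: IH.
  - by case: cT hn hpos {tT pT eb} => //= r cT; case: r => //= a r; lia.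
  - by rewrite eb; exact: tab_behead.
  - exact: subseq_pairwise (subseq_rd_behead _) pT.
under eq_bigr do rewrite e eb.
under [X in _ <= X]eq_bigr do rewrite e.
have -> : size (pmap ohead cT) = size (pmap ohead (map (map fst) cT)).
  by elim: (cT) => //= -[|a r] //= X ->.
exact: count_heads.
Qed.

Fixpoint row_colouring (c : nat) (T : seq (seq nat)) : seq (seq (nat * nat)) :=
  if T is r :: T' then [seq (a, c) | a <- r] :: row_colouring c.+1 T' else [::].

Lemma row_colouring_mem c T p : p \in reading (row_colouring c T) -> c <= p.2.
Proof.
elim: T c => //= r T IH c; rewrite mem_cat => /orP[/IH|/mapP[a _ ->]] //=; lia.
Qed.

(** Colouring each row by its index makes the first [k] rows into chains that attain the bound of
    [tab_chains_le]. *)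
Lemma has_chains_tab k T : tableau T -> has_chains k (reading T) (\sum_(i < k) size (nth [::] T i)).
Proof.
move=> tT; exists (reading (row_colouring 0 T)); split.
- elim: T 0 {tT} => //= r T IH c; rewrite map_cat IH -map_comp; congr (_ ++ _).
  by rewrite -[RHS]map_id.
- elim: T 0 tT => //= r T IH c /and3P[sr _ tT].
  rewrite pairwise_cat IH //=; apply/andP; split.
    apply/allrelP => -[p1 p2] q /row_colouring_mem /= h /mapP[a _ ->]; rewrite /compat /=; lia.
  rewrite pairwise_map; move: sr; rewrite sorted_pairwise; last exact: leq_trans.
  by apply: sub_pairwise => a b; rewrite /relpre /compat /= => ->; rewrite implybT.
- suff H c : count (coloured k) (reading (row_colouring c T)) = \sum_(i < k - c) size (nth [::] T i).
    by rewrite H subn0.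
  elim: T c {tT} => [|r T IH] c /=.
    by rewrite big1 // => i _; rewrite nth_nil.
  rewrite count_cat IH count_map.
  have [ck|kc] := ltnP c k; last first.
    have -> : k - c = 0 by lia.
    have -> : k - c.+1 = 0 by lia.
    rewrite !big_ord0 (eq_count (a2 := pred0)) ?count_pred0 // => a; rewrite /coloured /=; lia.
  have -> : k - c = (k - c.+1).+1 by lia.
  rewrite big_ord_recl /= addnC; congr (_ + _).
  by rewrite (eq_count (a2 := predT)) ?count_predT // => a; rewrite /coloured /= ck.
Qed.

Lemma rd_lift (T : seq (seq nat)) (cw : seq (nat * nat)) : map fst cw = reading T ->
  exists2 cT, map (map fst) cT = T & reading cT = cw.
Proof.
elim: T cw => [|r T IH] cw /=; first by case: cw => // _; exists [::].
case/map_eq_cat => c1 [c2 [-> /IH[cT <- <-] <-]].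
by exists (c2 :: cT).
Qed.

Lemma has_chains_tab_le k T m : tableau T -> has_chains k (reading T) m ->
  m <= \sum_(i < k) size (nth [::] T i).
Proof.
move=> tT [cw [/rd_lift[cT e <-] p <-]]; subst T.
apply: leq_trans (tab_chains_le tT p) _; apply: leq_sum => i _.
have [hi|hi] := ltnP i (size cT); first by rewrite (nth_map [::]) // size_map.
by rewrite !nth_default // size_map.
Qed.

(** * The Robinson-Schensted correspondence *)

(* The recording sequence is stored in reverse: its head is the row of the last box added. *)
Definition rsk_step (st : seq (seq nat) * seq nat) (x : nat) : seq (seq nat) * seq nat :=
  ((insert st.1 x).1, (insert st.1 x).2 :: st.2).

(** By column strictness, [d] rows suffice for letters [< d]. The multiplicity of [i] in the
    recording sequence is the length of row [i]. *)
Definition rsk (d : nat) (w : seq nat) : seq (seq nat) * seq nat :=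
  foldl rsk_step (nseq d [::], [::]) w.

Lemma rsk_rcons d w x : rsk d (rcons w x) = rsk_step (rsk d w) x.
Proof. exact: foldl_rcons. Qed.

Lemma all_rd (p : pred nat) T : all p (reading T) = all (all p) T.
Proof. by elim: T => //= r T IH; rewrite all_cat IH andbC. Qed.

Lemma nth_shape_ins T x i : (insert T x).2 < size T ->
  size (nth [::] (insert T x).1 i) = ((insert T x).2 == i) + size (nth [::] T i).
Proof.
move=> h; have e (X : seq (seq nat)) : size (nth [::] X i) = nth 0 (shape X) i.
  have [hi|hi] := ltnP i (size X); first by rewrite (nth_map [::]).
  by rewrite !nth_default // size_map.
by rewrite !e shape_ins // nth_incr_nth.
Qed.

Lemma rskP d w : all (gtn d) w ->
  [/\ tableau (rsk d w).1, size (rsk d w).1 = d, perm_eq w (reading (rsk d w).1),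
      chain_equiv w (reading (rsk d w).1) & all (gtn d) (rsk d w).2 /\
      forall i, size (nth [::] (rsk d w).1 i) = count_mem i (rsk d w).2].
Proof.
elim/last_ind: w => [|w x IH] /=.
  have e : reading (nseq d (@nil nat)) = [::] by elim: d => //= d ->.
  split; rewrite ?e //; last by split=> // i; rewrite nth_nseq; case: ifP.
  - by elim: d {e} => //= d ->; case: d.
  - by rewrite size_nseq.
rewrite all_rcons => /andP[xd wd]; have [tP sP pP cP [qP shP]] := IH wd.
have lt : (insert (rsk d w).1 x).2 < size (rsk d w).1.
  apply: (@ins_index d 0) => //; last by rewrite sP.
  by rewrite -all_rd -(perm_all _ pP).
rewrite rsk_rcons /=; split.
- exact: tab_ins.
- by rewrite size_ins.
- apply: perm_trans (perm_rd_ins lt).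
  by rewrite perm_rcons perm_cons.
- apply: (@chain_equiv_trans _ (rcons (reading (rsk d w).1) x)); last exact: chain_equiv_ins.
  by have := chain_equiv_ctx [::] [:: x] cP; rewrite /= !cats1.
- split; first by move: (lt); rewrite sP /= => ->.
  by move=> i; rewrite nth_shape_ins // shP.
Qed.

Lemma rsk_lt d w x : all (gtn d) w -> x < d -> (insert (rsk d w).1 x).2 < d.
Proof.
move=> wd xd; have [tP sP pP _ _] := rskP wd.
rewrite -{2}sP; apply: (@ins_index d 0) => //; last by rewrite sP.
by rewrite -all_rd -(perm_all _ pP).
Qed.

Lemma size_rsk d w : size (rsk d w).2 = size w.
Proof. by elim/last_ind: w => // w x IH; rewrite rsk_rcons size_rcons /= IH. Qed.

Lemma rsk_inj d w w' : all (gtn d) w -> all (gtn d) w' -> rsk d w = rsk d w' -> w = w'.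
Proof.
elim/last_ind: w w' => [|w x IH] w' wd wd' e.
  by have := size_rsk d w'; rewrite -e /=; case: w' {wd' e}.
case/lastP: w' wd' e => [|w' x'] wd' e.
  by have := size_rsk d (rcons w x); rewrite e /= size_rcons.
move: wd wd'; rewrite !all_rcons => /andP[xd wd] /andP[xd' wd'].
move: e; rewrite !rsk_rcons => -[e1 e2 e3].
have [tP sP _ _ _] := rskP wd; have [tP' sP' _ _ _] := rskP wd'.
have := un_ins tP; rewrite sP => /(_ x (rsk_lt wd xd)).
rewrite e1 e2 un_ins // ?sP' ?rsk_lt // => -[e4 <-].
by rewrite (IH w') // [LHS]surjective_pairing -e4 e3 -surjective_pairing.
Qed.

Lemma un_lt d T i : tableau T -> all (all (gtn d)) T -> corner T i ->
  all (all (gtn d)) (uninsert T i).1 /\ (uninsert T i).2 < d.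
Proof.
move=> tT aT cT; have [_ e s] := unP tT cT.
have := @perm_rd_ins (uninsert T i).1 (uninsert T i).2.
rewrite e s => /(_ (proj1 (andP cT))) /perm_all h.
by move: aT; rewrite -!all_rd -h /= => /andP[].
Qed.

Lemma nth_shape_un T i t : tableau T -> corner T i ->
  size (nth [::] T t) = (i == t) + size (nth [::] (uninsert T i).1 t).
Proof.
move=> tT cT; have [_ e s] := unP tT cT.
have := @nth_shape_ins (uninsert T i).1 (uninsert T i).2 t.
by rewrite e s; apply; case/andP: cT.
Qed.

(** Surjectivity for a fixed recording sequence: reverse bumping removes the boxes of [T] in the
    order opposite to that in which [u] created them. *)
Lemma rsk_same_shape d u T : all (gtn d) u -> tableau T -> size T = d -> all (all (gtn d)) T ->
  (forall i, size (nth [::] T i) = count_mem i (rsk d u).2) ->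
  exists2 u', all (gtn d) u' & rsk d u' = (T, (rsk d u).2).
Proof.
elim/last_ind: u T => [|u x IH] T ud tT sT aT shT.
  exists [::] => //=; congr pair; apply: (@eq_from_nth _ [::]); rewrite size_nseq ?sT //.
  move=> i hi; rewrite nth_nseq hi; apply/esym/nilP; rewrite /nilp.
  by rewrite shT.
move: ud; rewrite all_rcons => /andP[xd ud].
have [tP sP _ _ [_ shP]] := rskP ud.
move: shT; rewrite rsk_rcons /=; set i := (insert _ x).2 => shT.
have id : i < d by exact: rsk_lt.
have cT : corner T i.
  rewrite /corner sT id !shT /= eqxx -!shP.
  by have := tab_size_mono i tP; lia.
have [tU eU sU] := unP tT cT; have [aU xU] := un_lt tT aT cT.
have [|t|u' ud' e] := IH (uninsert T i).1 ud tU _ aU; first by rewrite sU.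
  by have := nth_shape_un t tT cT; rewrite shT /= => /addnI.
exists (rcons u' (uninsert T i).2); first by rewrite all_rcons /= xU.
by rewrite rsk_rcons /rsk_step e /= eU.
Qed.

(** Reverse bumping removes the two boxes in the other order, row [i] first, and [rsk_same_shape]
    supplies the rest of the word. The last condition excludes a vertical domino, where row [i] has
    no corner before the box below it is gone. *)
Lemma rsk_swap d w j i q : all (gtn d) w -> (rsk d w).2 = [:: j, i & q] -> i != j ->
  ~~ ((j == i.+1) && (count_mem j q == count_mem i q)) ->
  exists2 w', all (gtn d) w' & rsk d w' = ((rsk d w).1, [:: i, j & q]).
Proof.
case/lastP: w => // w y; case/lastP: w => [|u x] wd; first by rewrite rsk_rcons.
have [tT sT pT _ [_ shT]] := rskP wd.
have aT : all (all (gtn d)) (rsk d (rcons (rcons u x) y)).1.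
  by rewrite -all_rd -(perm_all _ pT).
move=> e; move: shT; rewrite e; set T := (rsk d _).1 in tT sT aT pT * => shT ij nadj.
move: wd e; rewrite !all_rcons !rsk_rcons /= => /and3P[yd xd ud].
move: (rsk_lt ud xd); set i' := (insert _ x).2 => i'd [ej ei eq].
have {}i'd : i < d by rewrite -ei.
have jd : j < d.
  by rewrite -ej -[(insert _ x).1]/(rsk_step (rsk d u) x).1 -rsk_rcons rsk_lt // all_rcons /= xd.
have [tP sP _ _ [_ shP]] := rskP ud; rewrite eq in shP.
have m t : count_mem t.+1 q <= count_mem t q by rewrite -!shP; exact: tab_size_mono.
have cT : corner T i.
  rewrite /corner sT i'd !shT /= eqxx.
  move: nadj ij (m i); case: (j =P i.+1) => [->|_]; move: (count_mem i.+1 q) (count_mem i q) => a b /=; lia.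
have [tU eU sU] := unP tT cT; have [aU xU] := un_lt tT aT cT.
have shU t : size (nth [::] (uninsert T i).1 t) = (j == t) + count_mem t q.
  by have := nth_shape_un t tT cT; rewrite shT /=; lia.
have cU : corner (uninsert T i).1 j.
  by rewrite /corner sU sT jd !shU eqxx; have := m j; lia.
have [tV eV sV] := unP tU cU; have [aV xV] := un_lt tU aU cU.
have shV t : size (nth [::] (uninsert (uninsert T i).1 j).1 t) = count_mem t (rsk d u).2.
  by have := nth_shape_un t tU cU; rewrite shU eq /= => /addnI.
have [|u' ud' e'] := rsk_same_shape ud tV _ aV shV; first by rewrite sV sU.
exists (rcons (rcons u' (uninsert (uninsert T i).1 j).2) (uninsert T i).2).
  by rewrite !all_rcons /= xU xV.
by rewrite !rsk_rcons /rsk_step e' /= eV eU eq.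
Qed.

(** * The involution of words that interchanges the last two boxes *)

Fixpoint words (d n : nat) : seq (seq nat) :=
  if n is m.+1 then [seq rcons u x | u <- words d m, x <- iota 0 d] else [:: [::]].

Lemma mem_words d n w : (w \in words d n) = (size w == n) && all (gtn d) w.
Proof.
elim: n w => [|n IH] w /=; first by rewrite inE; case: w.
apply/allpairsP/idP => [[[u x] /= [hu hx ->]]|].
  by move: hu hx; rewrite IH mem_iota size_rcons eqSS all_rcons /= => /andP[-> ->] ->.
case/lastP: w => // u x; rewrite size_rcons eqSS all_rcons => /and3P[su xd ud].
by exists (u, x); rewrite IH su ud mem_iota.
Qed.

Lemma uniq_words d n : uniq (words d n).
Proof.
elim: n => //= n IH; apply: allpairs_uniq => //; first exact: iota_uniq.
by move=> [u x] [v y] _ _ /= /rcons_inj[-> ->].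
Qed.

(** The preimage under [rsk] is found by search; if there is none, the default of [nth] leaves [w]
    fixed. *)
Definition swap_word (d : nat) (w : seq nat) : seq nat :=
  if (rsk d w).2 is [:: j, i & q] then
    let s := words d (size w) in
    nth w s (find (fun w' => rsk d w' == ((rsk d w).1, [:: i, j & q])) s)
  else w.

(** In [swap_wordK], the clause on all [w'] rules out that a moved word has a fixed image, since the
    original word would be the missing preimage. *)
Lemma swap_wordP d n w : w \in words d n ->
  swap_word d w \in words d n /\
  (if (rsk d w).2 is [:: j, i & q] then
     rsk d (swap_word d w) = ((rsk d w).1, [:: i, j & q]) \/
     [/\ swap_word d w = w, [/\ i != j, j == i.+1 & count_mem j q == count_mem i q] &
      forall w', all (gtn d) w' -> rsk d w' != ((rsk d w).1, [:: i, j & q])]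
   else swap_word d w = w).
Proof.
move=> hw; have := hw; rewrite mem_words => /andP[/eqP sw wd].
rewrite /swap_word; case E: (rsk d w).2 => [|j [|i q]] //.
rewrite sw; set p := fun _ => _; case hp: (has p (words d n)).
  split; first by rewrite mem_nth // -has_find.
  by left; apply/eqP; exact: (nth_find w hp).
rewrite nth_default; last by rewrite hasNfind ?hp.
split=> //; right.
have np w' : all (gtn d) w' -> rsk d w' != ((rsk d w).1, [:: i, j & q]).
  move=> wd'; apply: contraFneq hp => e; apply/hasP; exists w'; last by rewrite /p e.
  by rewrite mem_words wd' andbT -(size_rsk d w') e -sw -(size_rsk d w) E.
have ij : i != j.
  by apply/eqP => ij; subst j; have := np w wd; rewrite -E -surjective_pairing eqxx.
have [/andP[]|h] := boolP ((j == i.+1) && (count_mem j q == count_mem i q)); first by split.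
by have [w' wd' e] := rsk_swap wd E ij h; have := np w' wd'; rewrite e eqxx.
Qed.

Lemma swap_wordK d n w : w \in words d n -> swap_word d (swap_word d w) = w.
Proof.
move=> hw; have [hs] := swap_wordP hw; case E: (rsk d w).2 => [|j [|i q]].
- by move=> e; rewrite !e.
- by move=> e; rewrite !e.
case=> [e|[e _ _]]; last by rewrite !e.
have := (swap_wordP hs).2; rewrite e /=.
have [hs2 _] := swap_wordP hs; move: hw hs2; rewrite !mem_words => /andP[_ wd] /andP[_ wd2].
case=> [e2|[_ _ /(_ w wd)]].
  by apply: (rsk_inj wd2 wd); rewrite e2 -E -surjective_pairing.
by rewrite -E -surjective_pairing eqxx.
Qed.

(** * Shapes of random words *)

(* Reversing the word and complementing its letters keeps weakly increasing subsequences,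
   while the letters [>= k] become the letters [< d - k]. *)
Definition mirror (d n : nat) (w : word d n) : seq nat :=
  [seq (rev_ord (w (rev_ord i)) : nat) | i <- enum 'I_n].

Lemma mirror_lt d n (w : word d n) : all (gtn d) (mirror w).
Proof. by apply/allP => x /mapP[i _ ->]; exact: (ltn_ord (rev_ord (w (rev_ord i)))). Qed.

Lemma size_mirror d n (w : word d n) : size (mirror w) = n.
Proof. by rewrite size_map size_enum_ord. Qed.

Lemma nth_mirror d n (w : word d n) (i : 'I_n) :
  nth 0 (mirror w) i = rev_ord (w (rev_ord i)).
Proof. by rewrite (nth_map i) ?size_enum_ord // nth_ord_enum. Qed.

Lemma pairwise_ltn_enum n : pairwise (fun i j : 'I_n => i < j) (enum 'I_n).
Proof.
rewrite -(pairwise_map val ltn) val_enum_ord -sorted_pairwise; last exact: ltn_trans.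
exact: iota_ltn_sorted.
Qed.

Lemma count_enum n (p : pred 'I_n) : count p (enum 'I_n) = #|[set i | p i]|.
Proof. by rewrite cardsE cardE -size_filter /enum_mem filter_predT -enumT. Qed.

Lemma count_rev_ord n (p : pred 'I_n) :
  count (fun i => p (rev_ord i)) (enum 'I_n) = #|[set i | p i]|.
Proof.
rewrite count_enum -(card_imset _ rev_ord_inj); apply: eq_card => i; rewrite !inE.
apply/imsetP/idP => [[j]|pi]; first by rewrite inE => h ->.
by exists (rev_ord i); rewrite ?inE rev_ordK.
Qed.

Lemma valid_kseq_mirror d n k (w : word d n) (f : {ffun 'I_n -> option 'I_k}) : valid_kseq w f ->
  has_chains k (mirror w) #|[set i | f i != None]|.
Proof.
move=> /forallP hf.
(* Colour [k] encodes [None]. *)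
exists [seq ((rev_ord (w (rev_ord i)) : nat), oapp (@nat_of_ord k) k (f (rev_ord i))) | i <- enum 'I_n].
split.
- by rewrite -map_comp.
- rewrite pairwise_map; apply: sub_pairwise (pairwise_ltn_enum n) => i j ij.
  have /forallP/(_ (rev_ord i)) := hf (rev_ord j).
  rewrite /relpre /compat /=.
  have -> : n - j.+1 < n - i.+1 by have := ltn_ord j; lia.
  case: (f (rev_ord j)) => [c|] /=; last by move=> _; apply/implyP; lia.
  case: (f (rev_ord i)) => [c'|] /=; last by move=> _; apply/implyP; lia.
  move=> h; apply/implyP => /andP[/eqP e _].
  have {}e : c' = c by apply: val_inj.
  move: h; rewrite e eqxx /= => h; have := ltn_ord (w (rev_ord i)); lia.
- rewrite count_map -count_rev_ord; apply: eq_count => i; rewrite /coloured /=.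
  by case: (f _) => [c|] /=; rewrite ?ltn_ord ?ltnn.
Qed.

Lemma has_chains_mirror d n k (w : word d n) m : has_chains k (mirror w) m ->
  exists2 f : {ffun 'I_n -> option 'I_k}, valid_kseq w f & #|[set i | f i != None]| = m.
Proof.
move=> [cw [e hv <-]].
have scw : size cw = n by rewrite -(size_map fst) e size_mirror.
pose x0 := (0, k).
have cwE (i : 'I_n) : (nth x0 cw (rev_ord i)).1 = rev_ord (w i) :> nat.
  have := nth_mirror w (rev_ord i); rewrite -e (nth_map x0) ?scw ?ltn_ord // => ->.
  by rewrite rev_ordK.
exists [ffun i => insub (nth x0 cw (rev_ord i)).2].
  apply/forallP => i; apply/forallP => j; apply/implyP; rewrite !ffunE => /andP[/andP[ij]].
  case: insubP => // c ck ec _ /eqP; case: insubP => // c' ck' ec' [ecc].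
  have h := (pairwiseP x0 hv) (rev_ord j) (rev_ord i).
  have := h; rewrite !inE scw !ltn_ord /= => /(_ isT isT) {h}.
  have -> : n - j.+1 < n - i.+1 by have := ltn_ord j; lia.
  move=> /(_ isT); rewrite /compat -[n - j.+1]/(rev_ord j : nat) -[n - i.+1]/(rev_ord i : nat).
  rewrite !cwE -ec -ec' ecc eqxx ltn_ord /=.
  have := ltn_ord (w i); have := ltn_ord (w j); lia.
rewrite -count_rev_ord.
transitivity (count (fun i : 'I_n => coloured k (nth x0 cw i)) (enum 'I_n)).
  apply: eq_count => i; rewrite ffunE rev_ordK /coloured.
  by case: insubP => [c -> _|/negbTE ->].
rewrite -(count_map (fun i : 'I_n => nth x0 cw i) (coloured k)); congr count.
by rewrite (map_comp (nth x0 cw) val) val_enum_ord -scw -/(mkseq _ _) mkseq_nth.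
Qed.

(** Greene's theorem: [chain_equiv] replaces the mirrored word by the reading word of its tableau,
    where [has_chains_tab_le] and [has_chains_tab] give the two bounds. *)
Lemma greeneE d n k (w : word d n) :
  greene k w = \sum_(i < k) size (nth [::] (rsk d (mirror w)).1 i).
Proof.
have [tP _ _ cP _] := rskP (mirror_lt w).
have cE m : has_chains k (mirror w) m <-> has_chains k (reading (rsk d (mirror w)).1) m.
  by have := cP k m [::] [::]; rewrite /= !cats0.
apply/eqP; rewrite eqn_leq; apply/andP; split.
  apply/bigmax_leqP => f /valid_kseq_mirror/cE; exact: has_chains_tab_le.
have /cE/has_chains_mirror[f hf <-] := has_chains_tab k tP.
exact: (leq_bigmax_cond (F := fun f : {ffun 'I_n -> option 'I_k} => #|[set i | f i != None]|) f hf).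
Qed.

Lemma shRSK_rowE d n (w : word d n) i :
  shRSK_row w i = size (nth [::] (rsk d (mirror w)).1 i).
Proof. by rewrite /shRSK_row !greeneE big_ord_recr /= addKn. Qed.

Lemma rsk_filter d m w : all (gtn d) w ->
  (rsk d [seq x <- w | x < m]).1 = [seq [seq x <- r | x < m] | r <- (rsk d w).1].
Proof.
elim/last_ind: w => [_|w x IH] /=; first by rewrite map_nseq.
rewrite all_rcons => /andP[xd wd]; have [tP _ _ _ _] := rskP wd.
rewrite filter_rcons rsk_rcons /= ins_filter // -IH //.
by case: ifP => // xm; rewrite rsk_rcons.
Qed.

Lemma filter_lt d m w : all (gtn d) w -> all (gtn d) [seq x <- w | x < m].
Proof. by move/allP=> h; apply/allP => x; rewrite mem_filter => /andP[_ /h]. Qed.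

Lemma sum_count_mem d s : all (gtn d) s -> \sum_(t < d) count_mem (t : nat) s = size s.
Proof.
elim: s => [|x s IH] /=; first by rewrite big1.
case/andP=> xd /IH <-; rewrite big_split /= -add1n; congr (_ + _).
rewrite (bigD1 (Ordinal xd)) //= eqxx big1 // => t tx.
by case: (x =P t) => // e; case/eqP: tx; apply: val_inj.
Qed.

(** Chebyshev's sum inequality: the weights [2 * t + 1] increase with mean [d], while [f]
    decreases. *)
Lemma sum_odd_weights d (f : nat -> nat) : (forall t, f t.+1 <= f t) ->
  \sum_(t < d) (2 * t + 1) * f t <= d * \sum_(t < d) f t.
Proof.
move=> fm; elim: d => [|d IH]; first by rewrite !big_ord0.
have h : d * f d <= \sum_(t < d) f t.
  elim: (d) => [|e IHe]; first by rewrite big_ord0.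
  by rewrite big_ord_recr /=; apply: leq_trans (leq_mul (leqnn _) (fm e)) _; rewrite mulSnr leq_add2r.
rewrite !big_ord_recr /=; move: IH h; move: (\sum_(_ < _) _) (\sum_(_ < _) f _) => X Y; nia.
Qed.

Lemma lower_rows_le d (k : 'I_d) w : all (gtn d) w ->
  \sum_(i < d | k <= i) size (nth [::] (rsk d w).1 i) ^ 2 <=
  \sum_(t < d) count_mem (t : nat) (rsk d [seq x <- w | x < d - k]).2 ^ 2.
Proof.
move=> wd; have [tP _ pP _ _] := rskP wd.
have [_ _ _ _ [_ shF]] := rskP (filter_lt (d - k) wd).
rewrite -(big_geq_mkord k d xpredT (fun i => size (nth [::] (rsk d w).1 i) ^ 2)).
rewrite -[X in \sum_(X <= _ < _ | _) _]add0n.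
rewrite big_addn -(big_mkord xpredT (fun t => count_mem t _ ^ 2)).
rewrite (@big_cat_nat _ _ _ (d - k) 0 d) ?leq_subr //=.
apply: leq_trans (leq_addr _ _); apply: leq_sum => t _; rewrite leq_sqr -shF rsk_filter //.
have aP : all (all (gtn (d - k + k))) (rsk d w).1.
  by rewrite subnK ?(ltnW (ltn_ord k)) // -all_rd -(perm_all _ pP).
apply: leq_trans (tab_interlace t tP aP) _.
have [ht|ht] := ltnP t (size (rsk d w).1); last by rewrite nth_default.
by rewrite (nth_map [::]) // size_filter.
Qed.

Lemma row_mono d w : all (gtn d) w ->
  forall t, count_mem t.+1 (rsk d w).2 <= count_mem t (rsk d w).2.
Proof.
move=> wd t; have [tP _ _ _ [_ shP]] := rskP wd.
by rewrite -!shP; exact: tab_size_mono.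
Qed.

Local Open Scope ring_scope.

(** * Expected contents and binomial moments *)

Section Expectation.
Variables (R : realFieldType) (d : nat).

(** The weight [b] is arbitrary, so that identities also apply to the truncated weights of
    [restrict_weight]. *)
Definition expect (b : nat -> R) (n : nat) (F : seq nat -> R) : R :=
  \sum_(w <- words d n) (\prod_(x <- w) b x) * F w.

Lemma expect0 b F : expect b 0 F = F [::].
Proof. by rewrite /expect /= big_seq1 big_nil mul1r. Qed.

Lemma expectS b n F :
  expect b n.+1 F = expect b n (fun u => \sum_(x <- iota 0 d) b x * F (rcons u x)).
Proof.
rewrite /expect /= big_allpairs_dep /=; apply: eq_bigr => u _.
by rewrite mulr_sumr; apply: eq_bigr => x _; rewrite big_rcons mulrA.
Qed.

Lemma eq_expect b n F G : (forall w, size w = n -> all (gtn d) w -> F w = G w) ->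
  expect b n F = expect b n G.
Proof.
move=> h; apply: eq_big_seq => w; rewrite mem_words => /andP[/eqP sw wd].
by rewrite h.
Qed.

Lemma expectD b n F G : expect b n (fun w => F w + G w) = expect b n F + expect b n G.
Proof. by rewrite -big_split; apply: eq_bigr => w _; rewrite mulrDr. Qed.

Lemma expectZ b n c F : expect b n (fun w => c * F w) = c * expect b n F.
Proof. by rewrite /expect mulr_sumr; apply: eq_bigr => w _; rewrite mulrCA. Qed.

Lemma expect_sum b n m (F : 'I_m -> seq nat -> R) :
  expect b n (fun w => \sum_(t < m) F t w) = \sum_(t < m) expect b n (F t).
Proof. by rewrite exchange_big; apply: eq_bigr => w _; rewrite mulr_sumr. Qed.

Lemma le_expect b n F G : (forall x, (x < d)%N -> 0 <= b x) ->
  (forall w, size w = n -> all (gtn d) w -> F w <= G w) -> expect b n F <= expect b n G.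
Proof.
move=> b0 h; rewrite /expect big_seq [leRHS]big_seq; apply: ler_sum => w.
rewrite mem_words => /andP[/eqP sw wd]; rewrite ler_wpM2l ?h //.
by rewrite big_seq; apply: prodr_ge0 => x /(allP wd); exact: b0.
Qed.

(** The content of the last box minus that of the box before it, minus the sign that [row_bumping]
    translates into the order of the last two letters. *)
Definition content_defect (q : seq nat) : R :=
  if q is [:: j, i & r] then
    ((count_mem j (i :: r))%:R - j%:R) - ((count_mem i r)%:R - i%:R)
      - (if (j <= i)%N then 1 else - 1)
  else 0.

(** Interchanging boxes of different rows negates both the content difference and the sign. Dominoes
    are fixed by [swap_word] and have defect zero: the difference is [1] in a row and [- 1] in a
    column. *)
Lemma expect_content_defect b n :
  expect b n (fun w => content_defect (rsk d w).2) = 0.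
Proof.
set S := expect _ _ _; suff : S = - S by move=> ?; lra.
have p : perm_eq (words d n) (map (swap_word d) (words d n)).
  apply: uniq_perm; first exact: uniq_words.
    rewrite map_inj_in_uniq ?uniq_words // => w w' hw hw' /(congr1 (swap_word d)).
    by rewrite (swap_wordK hw) (swap_wordK hw').
  move=> w; apply/idP/mapP => [hw|[w' /swap_wordP[h _] ->//]].
  by exists (swap_word d w); [case: (swap_wordP hw)|rewrite (swap_wordK hw)].
rewrite {1}/S /expect (perm_big _ p) big_map -sumrN; apply: eq_big_seq => w hw.
have [hs H] := swap_wordP hw; rewrite -mulrN.
move: (hw) (hs); rewrite !mem_words => /andP[_ wd] /andP[_ sd].
case E: (rsk d w).2 H => [|j [|i q]] H.
- by rewrite H E /= oppr0 !mulr0.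
- by rewrite H E /= oppr0 !mulr0.
case: H => [e|[-> [ij /eqP ej /eqP c] _]].
  have [_ _ p1 _ _] := rskP wd; have [_ _ p2 _ _] := rskP sd.
  (* Equal insertion tableaux have the same letters, hence the two words have the same weight. *)
  rewrite (perm_big _ p2) e /= -(perm_big _ p1) /=; congr (_ * _).
  rewrite !natrD; case: (ltngtP i j) => h /=; try subst j; lra.
subst j; congr (_ * _); rewrite E /= (ltn_eqF (ltnSn i)) add0n c ltnn -natr1; lra.
Qed.

(** Twice the sum of the contents of the recorded shape. *)
Definition shape_energy (q : seq nat) : R :=
  \sum_(t < d) (count_mem (t : nat) q)%:R * ((count_mem (t : nat) q)%:R - 2 * t%:R - 1).

(** Twice the number of pairs of equal letters. *)
Definition letter_energy (w : seq nat) : R :=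
  \sum_(t < d) (count_mem (t : nat) w)%:R * ((count_mem (t : nat) w)%:R - 1).

Lemma shape_energy_cons i q : (i < d)%N ->
  shape_energy (i :: q) = shape_energy q + 2 * ((count_mem i q)%:R - i%:R).
Proof.
move=> id; rewrite /shape_energy (bigD1 (Ordinal id)) //= [in RHS](bigD1 (Ordinal id)) //= eqxx.
under eq_bigr => t ti.
  have -> : (i == t) = false by apply/eqP => e; case/eqP: ti; apply: val_inj.
  over.
by rewrite natrD /=; move: (\sum_(_ < _ | _) _) => X; ring.
Qed.

Lemma letter_energy_rcons x w : (x < d)%N ->
  letter_energy (rcons w x) = letter_energy w + 2 * (count_mem x w)%:R.
Proof.
move=> xd; rewrite /letter_energy (bigD1 (Ordinal xd)) //= [in RHS](bigD1 (Ordinal xd)) //=.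
under eq_bigr => t tx.
  have -> : count_mem (t : nat) (rcons w x) = count_mem (t : nat) w.
    rewrite -cats1 count_cat /=; have -> : (x == t) = false; last by rewrite !addn0.
    by apply/eqP => e; case/eqP: tx; apply: val_inj.
  over.
rewrite -cats1 count_cat /= eqxx addn0 natrD.
by rewrite /=; move: (\sum_(_ < _ | _) _) => X; ring.
Qed.

Definition energy_gap (w : seq nat) : R := shape_energy (rsk d w).2 - letter_energy w.

(** In the second difference, contents enter only through the difference of the last two boxes.
    Besides [content_defect], there remains a term antisymmetric in [x] and [y], which [sum_antisym]
    removes. *)
Lemma energy_gap_diff u y x : all (gtn d) u -> (y < d)%N -> (x < d)%N ->
  energy_gap (rcons (rcons u y) x) - 2 * energy_gap (rcons u y) + energy_gap u =
  2 * content_defect (rsk d (rcons (rcons u y) x)).2 +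
  2 * ((y <= x)%N%:R - (x <= y)%N%:R - (count_mem x u)%:R + (count_mem y u)%:R).
Proof.
move=> ud yd xd; have [tP sP _ _ _] := rskP ud.
have uyd : all (gtn d) (rcons u y) by rewrite all_rcons /= yd.
have jd := rsk_lt uyd xd; have id := rsk_lt ud yd.
have := @row_bumping (rsk d u).1 y x tP.
move: jd id; rewrite /energy_gap !letter_energy_rcons // !rsk_rcons /=.
set i := (insert _ y).2; set j := (insert _ x).2 => jd id.
rewrite sP => /(_ jd) ->.
rewrite !shape_energy_cons //= -cats1 count_cat /= addn0 !natrD.
by case: (ltngtP y x) => h /=; lra.
Qed.

Lemma sum_antisym (b : nat -> R) (f : nat -> nat -> R) :
  (forall y x, f x y = - f y x) ->
  \sum_(y <- iota 0 d) b y * \sum_(x <- iota 0 d) b x * f y x = 0.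
Proof.
move=> h; set S := LHS; suff : S = - S by move=> ?; lra.
rewrite {1}/S; under eq_bigr do rewrite mulr_sumr; rewrite exchange_big -sumrN.
apply: eq_bigr => y _; rewrite mulr_sumr -sumrN; apply: eq_bigr => x _.
by rewrite h; ring.
Qed.

(** With [S] the total weight of the letters and [E_n] the expectation, the vanishing second
    difference reads [E_(n+2) - 2 S E_(n+1) + S^2 E_n = 0], and [E_0 = E_1 = 0]. *)
Lemma expect_energy_gap b n : expect b n energy_gap = 0.
Proof.
have e0 : energy_gap [::] = 0.
  by rewrite /energy_gap /shape_energy /letter_energy !big1 ?subrr // => t _; rewrite mul0r.
have e1 x : (x < d)%N -> energy_gap [:: x] = 0.
  move=> xd; have := letter_energy_rcons [::] xd; have := rsk_rcons d [::] x.
  have : insert (nseq d [::]) x = ([:: x] :: nseq d.-1 [::], 0%N) by case: (d) xd.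
  move=> ei /= es el; move: e0; rewrite /energy_gap el es /rsk_step /= ei /=.
  rewrite shape_energy_cons; last by case: (d) xd.
  by rewrite /= => e; lra.
suff : expect b n energy_gap = 0 /\ expect b n.+1 energy_gap = 0 by case.
elim: n => [|n [IH0 IH1]]; split=> //.
- by rewrite expect0.
- rewrite expectS expect0 big_seq big1 // => x; rewrite mem_iota => xd /=.
  by rewrite e1 ?mulr0.
set S := \sum_(x <- iota 0 d) b x.
have : expect b n (fun u => \sum_(y <- iota 0 d) b y * \sum_(x <- iota 0 d) b x *
   (energy_gap (rcons (rcons u y) x) - 2 * energy_gap (rcons u y) + energy_gap u)) = 0.
  transitivity (expect b n (fun u => 2 * \sum_(y <- iota 0 d) b y * \sum_(x <- iota 0 d) b x *
     content_defect (rsk d (rcons (rcons u y) x)).2)); last first.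
    by rewrite expectZ; have := expect_content_defect b n.+2; rewrite !expectS => ->; rewrite mulr0.
  apply: eq_expect => u _ ud; apply/eqP; rewrite -subr_eq0; apply/eqP.
  pose f y x : R := 2 * ((y <= x)%N%:R - (x <= y)%N%:R - (count_mem x u)%:R + (count_mem y u)%:R).
  rewrite -[RHS](@sum_antisym b f); last by move=> y x; rewrite /f; ring.
  rewrite mulr_sumr -sumrB; apply: eq_big_seq => y; rewrite mem_iota => yd.
  rewrite mulrCA -mulrBr; congr (_ * _).
  rewrite mulr_sumr -sumrB; apply: eq_big_seq => x; rewrite mem_iota => xd.
  by rewrite energy_gap_diff // /f; ring.
move=> H; rewrite !expectS -[RHS]H.
transitivity (expect b n (fun u => \sum_(y <- iota 0 d) b y *
   (\sum_(x <- iota 0 d) b x * energy_gap (rcons (rcons u y) x))) +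
   (- 2 * S) * expect b n.+1 energy_gap + S ^+ 2 * expect b n energy_gap).
  by rewrite IH0 IH1 !mulr0 !addr0.
rewrite expectS -!expectZ -!expectD; apply: eq_expect => u _ _.
rewrite mulr_sumr -big_split /=.
have -> : S ^+ 2 * energy_gap u = \sum_(y <- iota 0 d) b y * (S * energy_gap u).
  by rewrite -mulr_suml -/S; ring.
rewrite -big_split /=; apply: eq_bigr => y _.
transitivity (b y * (\sum_(x <- iota 0 d) b x * energy_gap (rcons (rcons u y) x)
   + S * (- 2 * energy_gap (rcons u y) + energy_gap u))); first by ring.
congr (_ * _); rewrite /S mulr_suml -big_split /=; apply: eq_bigr => x _; ring.
Qed.

Definition restrict_weight (m : nat) (b : nat -> R) (x : nat) : R :=
  if (x < m)%N then b x else 0.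

(** A last letter [>= m] only contributes a scalar factor; a last letter [< m] turns [F] into [G],
    which inherits the hypothesis from words one letter longer. *)
Lemma expect_filter m b n F : (forall l, expect (restrict_weight m b) l F = 0) ->
  expect b n (fun w => F [seq x <- w | (x < m)%N]) = 0.
Proof.
elim: n F => [|n IH] F h; first by rewrite expect0 /=; have := h 0%N; rewrite expect0.
rewrite expectS.
pose c := \sum_(x <- iota 0 d) (b x - restrict_weight m b x).
pose G u := \sum_(x <- iota 0 d) restrict_weight m b x * F (rcons u x).
transitivity (expect b n (fun w => c * F [seq x <- w | (x < m)%N]
   + G [seq x <- w | (x < m)%N])).
  apply: eq_expect => u _ _; rewrite /c /G mulr_suml -big_split; apply: eq_bigr => x _ /=.
  rewrite filter_rcons /restrict_weight; case: ifP => _; ring.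
rewrite expectD expectZ IH // mulr0 add0r IH // => l.
by rewrite -expectS.
Qed.

(** Mean and second factorial moment of a binomial variable. *)
Lemma expect_count b n x : (x < d)%N -> \sum_(y <- iota 0 d) b y = 1 ->
  expect b n (fun w => (count_mem x w)%:R) = n%:R * b x /\
  expect b n (fun w => (count_mem x w)%:R * ((count_mem x w)%:R - 1)) =
    n%:R * (n%:R - 1) * b x ^+ 2.
Proof.
move=> xd b1.
have key c (f : seq nat -> R) u : \sum_(y <- iota 0 d) b y * (f u + (y == x)%:R * c) = f u + b x * c :> R.
  under eq_bigr do rewrite mulrDr; rewrite big_split /= -mulr_suml b1 mul1r; congr (_ + _).
  rewrite (bigD1_seq x) ?mem_iota ?iota_uniq //= eqxx mul1r big1 ?addr0 // => y /negbTE->.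
  by rewrite mul0r mulr0.
have one l : expect b l (fun=> 1) = 1.
  elim: l => [|l IH]; first by rewrite expect0.
  rewrite expectS -[RHS]IH; apply: eq_expect => u _ _; rewrite -[RHS]b1.
  by apply: eq_bigr => y _; rewrite mulr1.
elim: n => [|n [IH1 IH2]]; first by rewrite !expect0 /= !mul0r.
have cr u y : (count_mem x (rcons u y))%:R = (count_mem x u)%:R + (y == x)%:R :> R.
  by rewrite -cats1 count_cat /= addn0 natrD.
have E1 : expect b n.+1 (fun w => (count_mem x w)%:R) = n.+1%:R * b x.
  rewrite expectS.

  rewrite (@eq_expect b n _ (fun u => (count_mem x u)%:R + b x * 1)).
    by rewrite expectD expectZ one IH1 -natr1; ring.
  move=> u _ _; rewrite -(key 1 (fun u => (count_mem x u)%:R)).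
  by apply: eq_bigr => y _; rewrite cr mulr1.
split=> //; rewrite expectS.
rewrite (@eq_expect b n _ (fun u => (count_mem x u)%:R * ((count_mem x u)%:R - 1)
   + (2 * b x) * (count_mem x u)%:R)).
  by rewrite expectD expectZ IH1 IH2 -natr1; ring.
move=> u _ _; transitivity ((count_mem x u)%:R * ((count_mem x u)%:R - 1)
   + b x * (2 * (count_mem x u)%:R) : R); last by ring.
rewrite -(key (2 * (count_mem x u)%:R) (fun u => (count_mem x u)%:R * ((count_mem x u)%:R - 1))).
apply: eq_bigr => y _; rewrite cr; case: (y == x) => /=; ring.
Qed.

End Expectation.

(** The inequality before taking expectations: the gap will average to zero, and the other terms are
    sums over letters with binomial counts. *)
Lemma lower_rows_energy (R : realFieldType) d (k : 'I_d) w : all (gtn d) w ->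
  \sum_(i < d | (k <= i)%N) ((size (nth [::] (rsk d w).1 i) ^ 2)%N)%:R <=
  energy_gap R d [seq x <- w | (x < d - k)%N] +
  (\sum_(t < d) (t < d - k)%N%:R * ((count_mem (t : nat) w)%:R * ((count_mem (t : nat) w)%:R - 1))
  + d%:R * \sum_(t < d) (t < d - k)%N%:R * (count_mem (t : nat) w)%:R).
Proof.
move=> wd; rewrite -natr_sum.
set v := [seq x <- w | (x < d - k)%N]; have vd : all (gtn d) v by exact: filter_lt.
apply: le_trans (_ : (\sum_(t < d) count_mem (t : nat) (rsk d v).2 ^ 2)%N%:R <= _).
  by rewrite ler_nat; exact: lower_rows_le.
have cv (t : 'I_d) : (count_mem (t : nat) v)%:R = (t < d - k)%N%:R * (count_mem (t : nat) w)%:R :> R.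
  rewrite /v count_filter; have [h|h] := ltnP t (d - k); rewrite ?mul1r ?mul0r.
    by congr _%:R; apply: eq_count => x /=; case: eqP => // ->; rewrite h.
  rewrite (eq_count (a2 := pred0)) ?count_pred0 // => x /=.
  by case: eqP => // ->; rewrite ltnNge h.
have -> : \sum_(t < d) (t < d - k)%N%:R * (count_mem (t : nat) w)%:R = (size v)%:R :> R.
  by rewrite -(sum_count_mem vd) natr_sum; apply: eq_bigr => t _; rewrite cv.
have -> : \sum_(t < d) (t < d - k)%N%:R * ((count_mem (t : nat) w)%:R * ((count_mem (t : nat) w)%:R - 1))
   = letter_energy R d v.
  apply: eq_bigr => t _; rewrite cv; case: (_ < _)%N; rewrite ?mul1r ?mul0r //.
rewrite /energy_gap addrA subrK.
have [_ _ _ _ [qd _]] := rskP vd.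
have -> : (size v)%:R = (\sum_(t < d) count_mem (t : nat) (rsk d v).2)%N%:R :> R.
  by rewrite sum_count_mem // size_rsk.
rewrite -natrM.
apply: le_trans (_ : shape_energy R d (rsk d v).2 +
   (\sum_(t < d) (2 * t + 1) * count_mem (t : nat) (rsk d v).2)%N%:R <= _); last first.
  by rewrite lerD2l ler_nat; exact: (sum_odd_weights d (row_mono vd)).
rewrite /shape_energy !natr_sum -big_split /=; apply: ler_sum => t _.
by rewrite natrM natrD natrM natrX; set c := _%:R; lra.
Qed.

(** * Transfer to words as finite functions *)

Lemma size_words d n : size (words d n) = (d ^ n)%N.
Proof. by elim: n => //= n IH; rewrite size_allpairs IH size_iota expnSr. Qed.

Lemma mirror_inj d n : injective (@mirror d n).
Proof.
move=> w w' /eq_in_map h; apply/ffunP => i.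
have := h (rev_ord i) (mem_enum _ _); rewrite rev_ordK => /val_inj/rev_ord_inj.
exact.
Qed.

Lemma perm_words_mirror d n :
  perm_eq (words d n) [seq mirror w | w <- enum {: word d n}].
Proof.
rewrite perm_sym.
have u : uniq [seq mirror w | w <- enum {: word d n}].
  by rewrite map_inj_uniq ?enum_uniq //; exact: mirror_inj.
apply: uniq_perm => //; first exact: uniq_words.
apply: (uniq_min_size u _ _).2.
  by move=> v /mapP[w _ ->]; rewrite mem_words size_mirror eqxx mirror_lt.
by rewrite size_words size_map -cardE card_ffun !card_ord.
Qed.

Definition mirror_weight (R : realFieldType) d (alpha : 'I_d -> R) (x : nat) : R :=
  oapp (fun i => alpha (rev_ord i)) 0 (insub x).

Lemma mirror_weight_ord (R : realFieldType) d (alpha : 'I_d -> R) (i : 'I_d) :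
  mirror_weight alpha i = alpha (rev_ord i).
Proof. by rewrite /mirror_weight valK. Qed.

Lemma sum_words (R : realFieldType) d n (alpha : 'I_d -> R) (F : seq nat -> R) :
  \sum_(w : word d n) word_prob alpha w * F (mirror w) =
  expect d (mirror_weight alpha) n F.
Proof.
rewrite /expect (perm_big _ (perm_words_mirror d n)) big_map big_enum /=.
apply: eq_bigr => w _; congr (_ * _).
rewrite big_map big_enum /word_prob (reindex_inj rev_ord_inj).
by apply: eq_big => [i|i _]; rewrite ?inE ?mirror_weight_ord ?rev_ordK.
Qed.

(* k : 'I_d is 0-based: k here corresponds to k+1 in the paper. *)
Theorem mainTheorem9 (R : realFieldType) (d n : nat) (alpha : 'I_d -> R)
  (alpha_ge0 : forall i, 0 <= alpha i)
  (alpha_sum1 : \sum_(i < d) alpha i = 1)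
  (alpha_noninc : forall i j : 'I_d, (i <= j)%N -> alpha j <= alpha i)
  (k : 'I_d) :
  \sum_(w : word d n) word_prob alpha w *
      (\sum_(i < d | (k <= i)%N) ((shRSK_row w i) ^ 2)%:R)
  <= \sum_(i < d | (k <= i)%N) (alpha i * n%:R) ^+ 2
     + d%:R * (\sum_(i < d | (k <= i)%N) alpha i) * n%:R.
Proof.
set b := mirror_weight alpha.
have b0 x : (x < d)%N -> 0 <= b x.
  by move=> xd; rewrite -[x]/(nat_of_ord (Ordinal xd)) /b mirror_weight_ord.
have b1 : \sum_(x <- iota 0 d) b x = 1.
  rewrite -val_enum_ord big_map big_enum -alpha_sum1 [RHS](reindex_inj rev_ord_inj).
  by apply: eq_big => [i|i _]; rewrite ?inE // /b mirror_weight_ord.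
have tail (f : R -> R) :
    \sum_(i < d | (k <= i)%N) f (alpha i) = \sum_(t < d) (t < d - k)%N%:R * f (b t).
  rewrite big_mkcond (reindex_inj rev_ord_inj) /=; apply: eq_bigr => t _.
  rewrite /b mirror_weight_ord.
  have -> : (k <= d - t.+1)%N = (t < d - k)%N by have := ltn_ord t; have := ltn_ord k; lia.
  by case: ifP; rewrite ?mul1r ?mul0r.
pose F w : R := \sum_(i < d | (k <= i)%N) ((size (nth [::] (rsk d w).1 i) ^ 2)%N)%:R.
have -> : \sum_(w : word d n) word_prob alpha w *
    (\sum_(i < d | (k <= i)%N) ((shRSK_row w i) ^ 2)%:R) = expect d b n F.
  rewrite -sum_words; apply: eq_bigr => w _.
  by congr (_ * _); apply: eq_bigr => i _; rewrite shRSK_rowE.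
apply: le_trans (le_expect b0 (fun w _ wd => lower_rows_energy R k wd)) _.
(* By [expect_filter], the gap of the filtered word has expectation zero because it does so for
   every truncated weight. *)
rewrite expectD [X in _ + X <= _]expectD (expectZ d b n d%:R) !expect_sum expect_filter ?add0r; last exact: expect_energy_gap.
rewrite (tail (fun a => (a * n%:R) ^+ 2)) (tail id).
rewrite -mulrA mulr_suml; apply: lerD; last first.
  rewrite le_eqVlt; apply/orP; left; apply/eqP; congr (_ * _); apply: eq_bigr => t _.
  by rewrite expectZ (proj1 (expect_count n (ltn_ord t) b1)); ring.
(* The factorial moment [n (n - 1) b_t^2] is at most [(b_t n)^2]. *)
apply: ler_sum => t _; rewrite expectZ (proj2 (expect_count n (ltn_ord t) b1)).
rewrite ler_wpM2l ?ler0n // exprMn mulrC ler_wpM2l ?sqr_ge0 //.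
by rewrite expr2 mulrBr mulr1 gerBl ler0n.
Qed.
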